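(* Let $r \ge 2$ and $k>r+2$ be integers. Then for every positive integer $n$, $T_r(n,k-1)$ has the maximum number of hyperedges among all $n$-vertex Berge-$K_k$-free $r$-uniform hypergraphs.
   Context: All graphs and hypergraphs are finite and simple. $T_r(n,m)$ denotes the complete $m$-partite $n$-vertex $r$-uniform hypergraph in which all parts have size $\lfloor n/m\rfloor$ or $\lceil n/m\rceil$ (its hyperedges are all $r$-sets of vertices meeting each part in at most one vertex). A hypergraph $\mathcal{H}$ contains a Berge-$F$ (Berge copy of the graph $F$) if there are an injection $\varphi:V(F)\to V(\mathcal{H})$ and an injection $f:E(F)\to E(\mathcal{H})$ with $\{\varphi(u),\varphi(v)\}\subset f(uv)$ for every edge $uv\in E(F)$; otherwise it is Berge-$F$-free. *)

(* Defs.v *)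
From mathcomp Require Import all_boot.

Set Implicit Arguments.
Unset Strict Implicit.
Unset Printing Implicit Defensive.

(* A hypergraph on a vertex set V is its set of hyperedges H : {set {set V}};
   isolated vertices are allowed, so it has #|V| vertices.  A simple graph is
   a 2-uniform hypergraph. *)
Definition uniform (V : finType) (r : nat) (H : {set {set V}}) : Prop :=
  {in H, forall e : {set V}, #|e| = r}.

Definition complete_graph (k : nat) : {set {set 'I_k}} :=
  [set e : {set 'I_k} | #|e| == 2].

(* The map f on edges is a total function of which only the values on the
   edge set F matter. *)
Definition contains_Berge (U V : finType)
    (F : {set {set U}}) (H : {set {set V}}) : Prop :=
  exists (phi : U -> V) (f : {set U} -> {set V}),
    [/\ injective phi,
        {in F, forall e : {set U}, f e \in H},
        {in F &, injective f} &
        {in F, forall e : {set U}, phi @: e \subset f e}].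

Definition Berge_free (U V : finType)
    (F : {set {set U}}) (H : {set {set V}}) : Prop :=
  ~ contains_Berge F H.

Definition part (V : finType) (m : nat) (c : V -> 'I_m) (j : 'I_m) : {set V} :=
  [set x | c x == j].

Definition complete_multipartite (V : finType) (r m : nat) (c : V -> 'I_m) :
    {set {set V}} :=
  [set e : {set V} | (#|e| == r) && [forall j, #|e :&: part c j| <= 1]].

(* (n + m.-1) %/ m is the ceiling of n / m; parts may be empty. *)
Definition balanced (V : finType) (m : nat) (c : V -> 'I_m) : Prop :=
  forall j, #|part c j| = #|V| %/ m \/ #|part c j| = (#|V| + m.-1) %/ m.

(* T is a copy of T_r(#|V|, m) on the vertex set V. *)
Definition is_Turan (V : finType) (r m : nat) (T : {set {set V}}) : Prop :=
  exists2 c : V -> 'I_m, balanced c & T = complete_multipartite r c.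

Lemma count_residue (n m j : nat) : j < m ->
  \sum_(x < n) (x %% m == j) = (n + (m.-1 - j)) %/ m.
Proof.
move=> jm; have m0 : 0 < m by apply: leq_ltn_trans jm.
elim: n => [|n IH].
  rewrite big_ord0 add0n divn_small //.
  by rewrite (leq_ltn_trans (leq_subr _ _)) // prednK.
rewrite big_ord_recr /= IH addSn divnS // addnC; congr (_ + _).
have -> : (n + (m.-1 - j)).+1 = n + (m - j).
  by rewrite -addnS -subSn ?prednK // -ltnS prednK.
congr nat_of_bool; rewrite /dvdn addnBA 1?ltnW // -[in LHS](modn_small jm).
by rewrite -(eqn_modDr (m - j)) subnKC 1?ltnW // modnn addnBA 1?ltnW.
Qed.

(* T_r(n, m) exists: put the vertex x in the part of index x mod m. *)
Lemma Turan_exists (r n m : nat) : 0 < m ->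
  exists T : {set {set 'I_n}}, is_Turan r m T.
Proof.
move=> m0.
pose c (x : 'I_n) := Ordinal (ltn_pmod x m0).
exists (complete_multipartite r c), c => // j.
have -> : #|part c j| = (n + (m.-1 - j)) %/ m.
  rewrite -count_residue // -sum1_card big_mkcond /=.
  by apply: eq_bigr => x _; rewrite inE -val_eqE /=; case: (_ == _).
rewrite card_ord.
have lo : n %/ m <= (n + (m.-1 - j)) %/ m by rewrite leq_div2r ?leq_addr.
have hi : (n + (m.-1 - j)) %/ m <= (n + m.-1) %/ m.
  by rewrite leq_div2r // leq_add2l leq_subr.
have gap : (n + m.-1) %/ m <= (n %/ m).+1.
  have -> : (n %/ m).+1 = (n + m) %/ m by rewrite divnDr ?dvdnn // divnn m0 addn1.
  by rewrite leq_div2r // leq_add2l leq_pred.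
move: lo; rewrite leq_eqVlt => /orP[/eqP-> | lo]; [by left | right].
by apply/eqP; rewrite eqn_leq hi (leq_trans gap).
Qed.

(* Main.v *)
(* Matching hyperedges with pairs of vertices they contain, Kőnig's theorem turns
   a Berge-K_k-free H into a K_k-free graph with red and blue edges such that
   |H| is at most the number of red edges plus the number of blue r-cliques.
   Zykov symmetrization allows this graph to be taken complete multipartite with
   at most k - 1 classes.  When there are k - 1 >= r + 2 nonempty classes, the
   red edges are at most as many as the r-sets meeting each class at most once
   and containing a red edge, because 'C(k - 3, r - 2) >= 'C(r, 2).  So |H| is at
   most the number of r-sets meeting each class at most once, which is largest
   when the classes are balanced. *)
Require Import Defs.
From mathcomp Require Import all_boot zify.

Set Implicit Arguments.
Unset Strict Implicit.
Unset Printing Implicit Defensive.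

(** * Kőnig's theorem via edge-critical bipartite graphs *)

Definition vertex_cover (A B : finType) (E : {set A * B})
    (C : {set A} * {set B}) : bool :=
  [forall e in E, (e.1 \in C.1) || (e.2 \in C.2)].

(** Phrased as a boolean lower bound on the cover number, so that [minset] yields a graph in which
    no edge can be removed without losing the bound. *)
Definition cover_number_ge (A B : finType) (t : nat) (E : {set A * B}) : bool :=
  [forall C : {set A} * {set B}, vertex_cover E C ==> (t <= #|C.1| + #|C.2|)].

Lemma vertex_coverP (A B : finType) (E : {set A * B})
    (C : {set A} * {set B}) :
  reflect (forall a b, (a, b) \in E -> a \in C.1 \/ b \in C.2)
          (vertex_cover E C).
Proof.
apply: (iffP forall_inP) => [h a b /h /orP // | h [a b] /h /orP //].
Qed.

(* Uncrossing: two covers of size < t, each missing one of two edges at [a],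
   would recombine into two covers with total size < 2t. *)
Lemma critical_inj_fst (A B : finType) (t : nat) (M : {set A * B}) :
  minset (cover_number_ge t) M -> {in M &, injective fst}.
Proof.
case/minsetP=> /forallP ge_t minM [a x] [a' y] ax + /= eqa.
rewrite -{a'}eqa => ay; case: (eqVneq x y) => [-> // | neq_xy]; exfalso.
have crit e : e \in M ->
    exists2 C, vertex_cover (M :\ e) C & #|C.1| + #|C.2| < t.
  move=> eM; have : ~~ cover_number_ge t (M :\ e).
    apply/negP => /minM /(_ (subsetDl _ _)) eqM.
    by move: eM; rewrite -eqM !inE eqxx.
  by case/forallPn=> C; rewrite negb_imply -ltnNge => /andP[]; exists C.
have [[X1 Y1] /vertex_coverP /= c1 s1] := crit _ ax.
have [[X2 Y2] /vertex_coverP /= c2 s2] := crit _ ay.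
have c1' b z : (b, z) != (a, x) -> (b, z) \in M -> b \in X1 \/ z \in Y1.
  by move=> ne bz; apply: c1; rewrite in_setD1 ne.
have c2' b z : (b, z) != (a, y) -> (b, z) \in M -> b \in X2 \/ z \in Y2.
  by move=> ne bz; apply: c2; rewrite in_setD1 ne.
(* If [a] were in [X1], the removed edge would be covered too, giving a cover of all of [M] of size
   below [t]. *)
have noX1 : a \notin X1.
  apply/negP => aX; have := ge_t (X1, Y1); rewrite leqNgt s1 implybF => /negP[].
  apply/vertex_coverP => b z; case: (eqVneq (b, z) (a, x)) => [[-> _]|ne].
    by left.
  exact: c1'.
have noX2 : a \notin X2.
  apply/negP => aX; have := ge_t (X2, Y2); rewrite leqNgt s2 implybF => /negP[].
  apply/vertex_coverP => b z; case: (eqVneq (b, z) (a, y)) => [[-> _]|ne].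
    by left.
  exact: c2'.
(* As [a] lies in neither [X1] nor [X2], [y] must be in [Y1] and [x] in [Y2]; the union of the right
   sides thus covers both removed edges. *)
have g1 : t <= #|X1 :&: X2| + #|Y1 :|: Y2|.
  have /implyP /= := ge_t (X1 :&: X2, Y1 :|: Y2); apply.
  apply/vertex_coverP => b z bz /=; rewrite !inE.
  case: (eqVneq (b, z) (a, x)) => [[eb ez]|ne1].
    have [|bX|->] := c2' b z _ bz; last by right; rewrite orbT.
      by rewrite eb ez xpair_eqE eqxx.
    by rewrite eb (negPf noX2) in bX.
  case: (eqVneq (b, z) (a, y)) => [[eb ez]|ne2].
    have [bX|->] := c1' b z ne1 bz; last by right.
    by rewrite eb (negPf noX1) in bX.
  have [-> |->] := c1' b z ne1 bz; last by right.
  by have [-> |->] := c2' b z ne2 bz; [left | right; rewrite orbT].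
(* Adding [a] covers both removed edges at the cost of one vertex. The two covers then have total
   size at most 2(t - 1) + 1. *)
have g2 : t <= #|a |: (X1 :|: X2)| + #|Y1 :&: Y2|.
  have /implyP /= := ge_t (a |: (X1 :|: X2), Y1 :&: Y2); apply.
  apply/vertex_coverP => b z bz /=; rewrite !inE.
  case: (eqVneq b a) => [|nba]; first by left.
  have ne u : (b, z) != (a, u) by rewrite xpair_eqE (negPf nba).
  have [-> |->] := c1' b z (ne _) bz; first by left.
  by have [-> |->] := c2' b z (ne _) bz; [left; rewrite orbT | right].
move: g2; rewrite cardsU1 !inE (negPf noX1) (negPf noX2) /= => g2.
have := cardsUI X1 X2; have := cardsUI Y1 Y2; move: g1 g2 s1 s2 => /=.
move: #|X1 :|: X2| #|X1 :&: X2| #|Y1 :|: Y2| #|Y1 :&: Y2| => u i u' i'.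
move=> g1 g2 s1 s2 eY eX.
lia.
Qed.

Lemma swap_cover_number_ge (A B : finType) (t : nat) (E : {set A * B}) :
  cover_number_ge t [set (z.2, z.1) | z in E] = cover_number_ge t E.
Proof.
apply/forallP/forallP => h [X Y]; apply/implyP => /vertex_coverP /= c;
  have /implyP /= := h (Y, X); rewrite addnC; apply; apply/vertex_coverP => /=.
  by move=> b a /imsetP[[a' b'] ab [-> ->]]; have [] := c _ _ ab; [right|left].
move=> a b ab; have [|bX|aX] := c b a; [|by right|by left].
by apply/imsetP; exists (a, b).
Qed.

Lemma critical_inj_snd (A B : finType) (t : nat) (M : {set A * B}) :
  minset (cover_number_ge t) M -> {in M &, injective snd}.
Proof.
case/minsetP=> geM minM.
pose sw (U W : finType) (z : U * W) := (z.2, z.1).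
have swI (U W : finType) : injective (@sw U W) by move=> [? ?] [? ?] [-> ->].
have swK (U W : finType) (E : {set U * W}) : @sw W U @: (@sw U W @: E) = E.
  by rewrite -imset_comp -[RHS]imset_id; apply: eq_imset => -[].
have /critical_inj_fst h : minset (cover_number_ge t) (@sw A B @: M).
  apply/minsetP; rewrite swap_cover_number_ge; split=> // E geE subE.
  suff <- : @sw B A @: E = M by rewrite swK.
  apply: minM.
    by rewrite swap_cover_number_ge.
  by rewrite -[M]swK imsetS.
move=> u v uM vM eq_uv; apply: swI; apply: h => //; exact: imset_f.
Qed.

(** An edge-minimal subgraph with cover number at least that of [E] is a matching by the two
    critical lemmas. The first endpoints of its edges cover it, so it has at least as many edges as
    a minimum cover of [E] has vertices. *)
Lemma konig (A B : finType) (E : {set A * B}) :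
  exists (M : {set A * B}) (C : {set A} * {set B}),
    [/\ M \subset E, {in M &, injective fst}, {in M &, injective snd},
        vertex_cover E C & #|C.1| + #|C.2| <= #|M|].
Proof.
have cT : vertex_cover E (setT, setT) by apply/vertex_coverP; left; rewrite inE.
case: (arg_minnP (fun C : {set A} * {set B} => #|C.1| + #|C.2|) cT) => C cC minC.
have geE : cover_number_ge (#|C.1| + #|C.2|) E.
  by apply/forallP => D; apply/implyP => /minC.
have [M critM subM] := minset_exists geE; exists M, C.
have injM := critical_inj_fst critM.
split=> //; first exact: critical_inj_snd critM.
have /minsetP[/forallP /(_ ([set z.1 | z in M], set0)) /implyP /= + _] := critM.
rewrite cards0 addn0 card_in_imset //; apply.
by apply/vertex_coverP => a b ab; left; apply/imsetP; exists (a, b).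
Qed.

(** * Red and blue pairs of a Berge-free hypergraph *)

Definition cliques (V : finType) (r : nat) (G : {set {set V}}) :
    {set {set V}} :=
  [set S : {set V} | (#|S| == r) &&
     [forall e : {set V}, (#|e| == 2) && (e \subset S) ==> (e \in G)]].

(* A minimum vertex cover and a maximum matching of the incidence graph between
   hyperedges and pairs: Blue is the set of pairs in the cover, Red that of the
   other matched pairs.  The hyperedges in the cover are matched to Red, and all
   pairs of the other hyperedges are Blue. *)
Lemma red_blue_graph (W : finType) (r k : nat) (H : {set {set W}}) :
    uniform r H -> Berge_free (complete_graph k) H ->
  exists Red Blue : {set {set W}},
    [/\ [disjoint Red & Blue],
        {in Red :|: Blue, forall e : {set W}, #|e| = 2},
        forall phi : 'I_k -> W, injective phi ->
          ~ {in complete_graph k, forall e : {set 'I_k},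
               phi @: e \in Red :|: Blue} &
        #|H| <= #|Red| + #|cliques r Blue|].
Proof.
move=> uH fH.
pose E := [set z : {set W} * {set W} |
             [&& z.1 \in H, #|z.2| == 2 & z.2 \subset z.1]].
have [M [[X Y] [/subsetP subM inj1 inj2 /vertex_coverP /= cE sizeM]]] := konig E.
rewrite /= in sizeM.
pose G := [set z.2 | z in M].
have cardG : #|G| = #|M| by rewrite card_in_imset.
have leX : #|G :\: Y| <= #|X|.
  pose N := [set z in M | z.2 \notin Y].
  have NM : {subset N <= M} by move=> z; rewrite inE => /andP[].
  have <- : [set z.2 | z in N] = G :\: Y.
    apply/setP => e; apply/imsetP/setDP => [[z]|[/imsetP[z zM ->] zY]].
      by rewrite inE => /andP[zM zY] ->; split=> //; apply: imset_f.
    by exists z => //; rewrite inE zM.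
  rewrite card_in_imset; last by move=> u v /NM uM /NM vM; apply: inj2.
  rewrite -(card_in_imset (f := fst)); last first.
    by move=> u v /NM uM /NM vM; apply: inj1.
  apply/subset_leq_card/subsetP => e /imsetP[[a b]].
  rewrite inE /= => /andP[/subM /cE[aX _ -> //|-> //]].
(* |Y| + |G \ Y| <= |Y| + |X| <= |M| = |G|, which forces every pair of the cover to be matched. *)
have YG : Y \subset G.
  apply/setIidPr/eqP; rewrite eqEcard subsetIr /=.
  rewrite -(leq_add2r #|G :\: Y|) cardsID cardG (leq_trans _ sizeM) //.
  by rewrite addnC leq_add2r.
exists (G :\: Y), Y.
have GY : G :\: Y :|: Y = G.
  by apply/setP => e; rewrite !inE; have /subsetP/(_ e) := YG;
     case: (e \in Y) => //= [->|_]; rewrite ?orbF.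
rewrite GY; split.
- by rewrite -setI_eq0 setIDAC setDIl setDv setI0.
- by move=> e /imsetP[z /subM + ->]; rewrite inE => /and3P[_ /eqP].
- move=> phi injphi hphi; apply: fH.
  (* [f e] is the hyperedge matched to the pair [phi @: e]; the default [set0] is never taken on
     edges. Each hyperedge is matched at most once, so distinct edges get distinct hyperedges. *)
  pose f (e : {set 'I_k}) : {set W} :=
    odflt set0 (omap fst [pick z in M | z.2 == phi @: e]).
  have fP : {in complete_graph k, forall e, (f e, phi @: e) \in M}.
    move=> e /hphi /imsetP[[a b] zM /= eqb]; rewrite /f.
    case: pickP => [[a' b'] /= /andP[zM' /eqP <-] //|/(_ (a, b))].
    by rewrite zM /= eqb eqxx.
  exists phi, f; split=> //.
  - by move=> e /fP /subM; rewrite inE => /and3P[].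
  - move=> e1 e2 /fP m1 /fP m2 eqf; apply: (imset_inj injphi).
    by have [] := inj1 _ _ m1 m2 eqf.
  - by move=> e /fP /subM; rewrite inE => /and3P[].
- rewrite -(cardsID X H) leq_add //.
    rewrite (leq_trans (subset_leq_card (subsetIr _ _))) //.
    rewrite -(leq_add2r #|Y|) (leq_trans sizeM) // -cardG -(cardsID Y G).
    by rewrite (setIidPr YG) addnC.
  apply/subset_leq_card/subsetP => S /setDP[SH SX].
  rewrite inE uH // eqxx; apply/forall_inP => e /andP[e2 eS].
  have [||//] := cE S e; first by rewrite inE SH e2.
  by rewrite (negPf SX).
Qed.

(** * Rainbow sets, Zykov symmetrization and red pairs *)

(** The fibres of [q] act as the classes of a complete multipartite graph, whose cliques are then
    the rainbow sets. *)
Definition rainbow (V I : finType) (q : V -> I) (S : {set V}) : bool :=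
  #|q @: S| == #|S|.

Lemma rainbowP (V I : finType) (q : V -> I) (S : {set V}) :
  reflect {in S &, injective q} (rainbow q S).
Proof. exact: imset_injP. Qed.

Lemma leq_sum_sub (I : finType) (P Q : pred I) (F : I -> nat) :
  subpred P Q -> \sum_(i | P i) F i <= \sum_(i | Q i) F i.
Proof.
move=> PQ; apply: (sub_le_big (le := leq)) => // m n; exact: leq_addr.
Qed.

(* Induction on A: the vertex v of A in the largest total weight replaces all
   vertices of A that are not adjacent to it, and the weight of v is transferred
   to its neighbourhood. *)
Lemma symmetrization (V : finType) (adj : rel V) (A : {set V})
    (w : {set V} -> nat) :
    irreflexive adj -> symmetric adj ->
    (forall S, 0 < w S -> {in S &, forall x y, x != y -> adj x y}) ->
  exists p : V -> V,
    [/\ {in A, forall x, p x \in A}, {in A, forall x, p (p x) = p x},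
        {in A &, forall x y, p x != p y -> adj (p x) (p y)} &
        \sum_(S : {set V} | S \subset A) w S <=
        \sum_(S : {set V} | (S \subset A) && rainbow p S) w (p @: S)].
Proof.
move=> irr sym; have [n] := ubnP #|A|; elim: n => // n IH in A w * => /ltnSE leAn wadj.
have [->|[v0 v0A]] := set_0Vmem A.
  exists id; split=> //; try by move=> x; rewrite inE.
  rewrite (eq_bigl (fun S : {set V} => (S \subset set0) && rainbow id S)).
    by rewrite leq_sum // => S _; rewrite imset_id.
  by move=> S; rewrite /rainbow imset_id eqxx andbT.
pose d v := \sum_(S : {set V} | (S \subset A) && (v \in S)) w S.
case: (arg_maxnP (P := [in A]) d v0A) => v vA dmax.
pose B := [set x in A | adj v x].
have BA : B \subset A by apply/subsetP => x; rewrite inE => /andP[].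
have vB : v \notin B by rewrite inE irr andbF.
(* Every vertex of [A :\: B], including [v] itself, becomes a copy of [v], so a set in [B] can be
   extended by a copy of [v] in [#|A :\: B|] ways. *)
pose w' (S : {set V}) := w S + #|A :\: B| * w (v |: S).
have [|S|p [pB pp padj le_p]] := IH B w'.
- by rewrite (leq_trans _ leAn) //; apply/proper_card/properP; split=> //; exists v.
- rewrite addn_gt0 muln_gt0 => /orP[/wadj //|/andP[_ /wadj h]] x y xS yS.
  by apply: h; rewrite inE ?xS ?yS orbT.
pose p' x := if x \in B then p x else v.
have p'B x : x \in B -> p' x = p x by rewrite /p' => ->.
have p'BN x : x \notin B -> p' x = v by rewrite /p' => /negPf ->.
have adjB x : x \in B -> adj v x by rewrite inE => /andP[].
exists p'; split.
- move=> x xA; have [xB|xB] := boolP (x \in B); last by rewrite p'BN.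
  by rewrite p'B // (subsetP BA) // pB.
- move=> x xA; have [xB|xB] := boolP (x \in B); last by rewrite (p'BN x) // p'BN.
  by rewrite (p'B x) // p'B ?pB // pp.
- move=> x y _ _; have [xB|xB] := boolP (x \in B);
    have [yB|yB] := boolP (y \in B).
  + by rewrite !p'B //; exact: padj.
  + by rewrite p'B // p'BN // => _; rewrite sym adjB // pB.
  + by rewrite p'BN // p'B // => _; rewrite adjB // pB.
  + by rewrite !p'BN // eqxx.
have p'S (S : {set V}) : S \subset B -> p' @: S = p @: S.
  by move=> /subsetP SB; apply: eq_in_imset => x /SB /p'B.
have trB (S : {set V}) : S \subset B -> rainbow p' S = rainbow p S.
  by move=> SB; rewrite /rainbow p'S.
(* A set not inside [B] is counted in [d x] for some [x] in [A :\: B], and [d x <= d v]. A set of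
   positive weight containing [v] has its other vertices in [B], which bounds [d v] by the sum of
   [w (v |: S)]. *)
have le1 : \sum_(S : {set V} | S \subset A) w S <=
           \sum_(S : {set V} | S \subset B) w' S.
  rewrite big_split /= -big_distrr /=.
  rewrite (bigID (fun S : {set V} => S \subset B)) /= leq_add //.
    by apply: leq_sum_sub => S /andP[].
  apply: (@leq_trans (\sum_(x in A :\: B) d x)).
    rewrite (exchange_big_dep (fun S : {set V} => S \subset A)) /=; last first.
      by move=> ? ? _ /andP[].
    rewrite [X in _ <= X](bigID (fun S : {set V} => S \subset B)) /=.
    apply: leq_trans (leq_addl _ _); apply: leq_sum => S /andP[SA /subsetPn[x xS xB]].
    rewrite (bigD1 x) /= ?leq_addr // SA xS !inE andbT.
    by move: xB; rewrite inE (subsetP SA) // => ->.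
  rewrite -sum_nat_const; apply: leq_sum => x /setDP[xA _].
  apply: leq_trans (dmax x xA) _; rewrite /d.
  rewrite (bigID (fun S : {set V} => S :\ v \subset B)) /= [X in _ + X]big1.
    rewrite addn0 (reindex_onto (fun S : {set V} => v |: S) (fun S => S :\ v)) /=.
      apply: leq_sum_sub => S /andP[/andP[_ h1] /eqP h2].
      by rewrite h2 in h1.
    by move=> S /andP[/andP[_ vS] _]; rewrite setD1K.
  move=> S /andP[/andP[SA vS] /subsetPn[y]]; rewrite !inE => /andP[yv yS].
  rewrite (subsetP SA) //= => nadj; apply/eqP; rewrite -leqn0 leqNgt.
  by apply/negP => /wadj /(_ v y vS yS); rewrite eq_sym yv (negPf nadj) => /(_ isT).
apply: leq_trans le1 (leq_trans le_p _); rewrite big_split /= -big_distrr /=.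
rewrite [X in _ <= X](bigID (fun S : {set V} => S \subset B)) /= leq_add //.
  rewrite [X in _ <= X](eq_bigl (fun S : {set V} => (S \subset B) && rainbow p S)).
    by apply: leq_sum => S /andP[SB _]; rewrite p'S.
  move=> S; have [SB|] := boolP (S \subset B); last by rewrite andbF.
  by rewrite (subset_trans SB BA) trB // andbT.
(* Adding one vertex outside [B] to a rainbow set inside [B] gives, injectively, rainbow sets for
   [p'] not contained in [B]; their images are the sets [v |: p @: S]. *)
pose h (z : V * {set V}) := z.1 |: z.2.
pose D := setX (A :\: B) [set S : {set V} | (S \subset B) && rainbow p S].
have DP z : z \in D ->
    [/\ z.1 \in A, z.1 \notin B, z.2 \subset B & rainbow p z.2].
  by case: z => x S /setXP[/setDP[-> ->]]; rewrite inE => /andP[-> ->].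
have hB z : z \in D -> h z :&: B = z.2.
  case/DP=> _ nB zB _; apply/setP => x; rewrite !inE.
  have [->|/=] := eqVneq x z.1; last first.
    by move=> _; case: (boolP (x \in z.2)) => [/(subsetP zB)|//]; rewrite inE.
  have /negPf -> : z.1 \notin z.2 by apply: contra nB; apply: subsetP.
  by move: nB; rewrite inE => /negPf ->.
have hI : {in D &, injective h}.
  move=> u z uD zD eqh; have e2 : u.2 = z.2 by rewrite -hB // eqh hB.
  case: (DP _ uD) (DP _ zD) => _ uB _ _ [_ _ zB _].
  have : u.1 \in h z by rewrite -eqh setU11.
  case/setU1P=> [e1|/(subsetP zB)]; last by rewrite (negPf uB).
  by rewrite [u]surjective_pairing e1 e2 -surjective_pairing.
have -> : #|A :\: B| *
    \sum_(S : {set V} | (S \subset B) && rainbow p S) w (v |: p @: S) =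
    \sum_(S in h @: D) w (p' @: S).
  rewrite big_imset //= -sum_nat_const pair_big /=; apply: eq_big => [z|z].
    by rewrite !inE.
  case/andP=> /setDP[_ nB] /andP[zB _].
  by rewrite imsetU1 p'BN // p'S.
apply: leq_sum_sub => S /imsetP[z zD ->]; have [zA nB zB ptr] := DP _ zD.
rewrite subUset sub1set zA (subset_trans zB BA) /=; apply/andP; split; last first.
  by apply: contra nB => /subsetP; apply; rewrite setU11.
rewrite /rainbow imsetU1 p'BN // p'S // !cardsU1 (eqP ptr).
have -> : v \notin p @: z.2.
  by apply: contra vB => /imsetP[x /(subsetP zB) xB ->]; apply: pB.
by rewrite (contra (subsetP zB _)).
Qed.

(* Each red pair lies in at least 'C(#|L| - 2, r - 2) >= 'C(r, 2) of the
   rainbow r-sets, and an r-set contains only 'C(r, 2) pairs. *)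
Lemma red_pairs_le_rainbows (V : finType) (q : V -> V) (L : {set V})
    (r : nat) (R : {set {set V}}) :
    1 < r -> r + 2 <= #|L| -> (forall x, q x \in L) ->
    {in L, forall x, q x = x} ->
    {in R, forall e : {set V}, #|e| = 2 /\ rainbow q e} ->
  #|R| <= #|[set S : {set V} | [&& #|S| == r, rainbow q S &
                                [exists e in R, e \subset S]]]|.
Proof.
move=> r1 rL qL qid RP; set X := finset _.
have C0 : 0 < 'C(r, 2) by rewrite bin_gt0.
rewrite -(leq_pmul2r C0) -sum_nat_const.
apply: (@leq_trans (\sum_(e in R) \sum_(S in X | e \subset S) 1)).
  apply: leq_sum => e eR; have [e2 etr] := RP e eR.
  have Le : #|L :\: q @: e| = #|L| - 2.
    by rewrite cardsDS ?(eqP etr) ?e2 //; apply/subsetP => _ /imsetP[x _ ->].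
  (* In this form the bound is monotonicity in the upper argument, from r <= |L| - 2. *)
  have -> : 'C(r, 2) = 'C(r, r - 2) by rewrite bin_sub.
  apply: (@leq_trans 'C(#|L :\: q @: e|, r - 2)).
    by rewrite Le leq_bin2l //; lia.
  (* [L] consists of class representatives. Adding to [e] any r - 2 of them from classes that [e]
     misses gives a rainbow r-set. *)
  rewrite -cards_draws sum1dep_card; set D := finset _.
  have DP Q : Q \in D -> [/\ Q \subset L, [disjoint e & Q],
      q @: Q = Q, [disjoint q @: e & Q] & #|Q| = r - 2].
    rewrite inE => /andP[/subsetDP[QL dQ] /eqP ->].
    have qQ : {in Q, forall x, q x = x} by move=> x /(subsetP QL) /qid.
    split=> //; last by rewrite disjoint_sym.
      apply/pred0P => x /=; apply/negP => /andP[xe xQ].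
      by have := disjointFr dQ xQ; rewrite -(qQ x xQ) imset_f.
    by rewrite -[RHS]imset_id; apply: eq_in_imset.
  have hI : {in D &, injective (setU e)}.
    move=> Q Q' /DP[_ dQ _ _ _] /DP[_ dQ' _ _ _] eqU.
    have U (P : {set V}) : [disjoint e & P] -> (e :|: P) :\: e = P.
      by rewrite setDUl setDv set0U disjoint_sym => /setDidPl.
    by rewrite -(U _ dQ) eqU U.
  rewrite -(card_in_imset hI); apply/subset_leq_card/subsetP => S.
  case/imsetP=> Q /DP[QL dQ qQ dqQ cQ] ->.
  rewrite !inE subsetUl andbT /rainbow imsetU qQ !cardsU.
  rewrite (disjoint_setI0 dQ) (disjoint_setI0 dqQ) (eqP etr) eqxx /=.
  rewrite cards0 e2 cQ subn0 subnKC // eqxx /=.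
  by apply/exists_inP; exists e; rewrite ?subsetUl.
rewrite (exchange_big_dep (mem X)) /=; last by move=> ? ? _ /andP[].
rewrite -sum_nat_const; apply: leq_sum => S; rewrite inE => /and3P[/eqP <- _ _].
rewrite sum1dep_card -cards_draws; apply/subset_leq_card/subsetP => e.
by rewrite !inE => /and3P[/RP[-> _] _ ->]; rewrite eqxx.
Qed.

(** * Counting rainbow sets and balancing the classes *)

Definition elem_sym (I : finType) (r : nat) (n : I -> nat) : nat :=
  \sum_(Q : {set I} | #|Q| == r) \prod_(i in Q) n i.

(** A rainbow set with image [Q] chooses one vertex in each fibre over [Q]; the induction splits off
    the vertex of one colour [i]. *)
Lemma card_rainbows_onto (V I : finType) (q : V -> I) (Q : {set I}) :
  #|[set S : {set V} | rainbow q S & q @: S == Q]| =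
  \prod_(i in Q) #|q @^-1: [set i]|.
Proof.
have [n] := ubnP #|Q|; elim: n => // n IH in Q * => /ltnSE leQn.
have [->|[i iQ]] := set_0Vmem Q.
  rewrite big_set0 (_ : finset _ = [set set0]) ?cards1 //.
  apply/setP => S; rewrite !inE imset_eq0.
  by case: eqP => [->|]; rewrite ?andbF // /rainbow imset0 !cards0.
rewrite (big_setD1 i) //= -IH; last first.
  by rewrite (leq_trans _ leQn) // [in X in _ < X](cardsD1 i) iQ.
set P := q @^-1: _; set D := [set S | _ & _ == Q :\ i].
pose h (z : V * {set V}) := z.1 |: z.2.
have DP z : z \in setX P D ->
    [/\ q z.1 = i, rainbow q z.2, q @: z.2 = Q :\ i & z.1 \notin z.2].
  case: z => x S /setXP[]; rewrite !inE => /eqP qx /andP[tr /eqP qS] /=.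
  split=> //; apply/negP => xS; have : q x \in q @: S by apply: imset_f.
  by rewrite qS qx !inE eqxx.
have hI : {in setX P D &, injective h}.
  have hP z : z \in setX P D -> h z :&: P = [set z.1].
    case/DP=> qz tr qS nz; apply/setP => x; rewrite !inE.
    have [->|/= _] := eqVneq x z.1; first by rewrite qz eqxx.
    apply/negP => /andP[xS /eqP qx]; have : q x \in q @: z.2 by apply: imset_f.
    by rewrite qS qx !inE eqxx.
  move=> u z uD zD eqh.
  have /set1_inj e1 : [set u.1] = [set z.1] by rewrite -!hP // eqh.
  have [_ _ _ nu] := DP _ uD; have [_ _ _ nz] := DP _ zD.
  have e2 : u.2 = z.2 by rewrite -(setU1K nu) -(setU1K nz) -e1 -/(h u) eqh e1.
  by rewrite [u]surjective_pairing e1 e2 -surjective_pairing.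
rewrite -cardsX -(card_in_imset hI); apply: eq_card => S.
apply/idP/imsetP => [|[z zD ->]].
  rewrite inE => /andP[tr /eqP qS].
  have /imsetP[x xS ix] : i \in q @: S by rewrite qS.
  exists (x, S :\ x); last by rewrite /h /= setD1K.
  apply/setXP; rewrite !inE -ix eqxx; split=> //.
  have /rainbowP injS := tr.
  apply/andP; split.
    by apply/rainbowP => y z /setD1P[_ yS] /setD1P[_ zS]; apply: injS.
  rewrite eqEsubset; apply/andP; split; apply/subsetP => j.
    case/imsetP=> y /setD1P[yx yS] ->; rewrite !inE -qS imset_f // andbT ix.
    by apply: contra yx => /eqP /injS -> //.
  rewrite -qS => /setD1P[ji /imsetP[y yS jy]]; apply/imsetP; exists y => //.
  by rewrite !inE yS andbT; apply: contra ji => /eqP yx; rewrite jy yx ix.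
have [qz tr qS nz] := DP _ zD.
rewrite inE /rainbow imsetU1 qz qS setD1K // eqxx andbT.
by rewrite cardsU1 nz -(eqP tr) qS (cardsD1 i) iQ.
Qed.

Lemma card_rainbows (V I : finType) (q : V -> I) (r : nat) :
  #|[set S : {set V} | (#|S| == r) && rainbow q S]| =
  elem_sym r (fun i => #|q @^-1: [set i]|).
Proof.
rewrite -sum1dep_card (partition_big (fun S : {set V} => q @: S)
  (fun Q : {set I} => #|Q| == r)) /=.
  apply: eq_bigr => Q /eqP Qr.
  rewrite -card_rainbows_onto sum1dep_card; apply: eq_card => S.
  rewrite !inE; case: (eqVneq (q @: S) Q) => [eqS|_]; rewrite ?andbF ?andbT //.
  case: (boolP (rainbow q S)) => tr; rewrite ?andbF //.
  by rewrite -(eqP tr) eqS Qr eqxx.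
by move=> S /andP[/eqP <- /eqP ->].
Qed.

Lemma big_set_split (I : finType) (i : I) (P : pred {set I})
    (F : {set I} -> nat) :
    (forall Q, P (i |: Q) = P Q) ->
  \sum_(Q | P Q) F Q = \sum_(Q | P Q && (i \notin Q)) (F Q + F (i |: Q)).
Proof.
move=> Pi; rewrite (bigID (fun Q : {set I} => i \notin Q)) big_split /=.
congr (_ + _).
rewrite (reindex_onto (fun Q : {set I} => i |: Q) (fun Q => Q :\ i)) /=.
  apply: eq_bigl => Q; rewrite Pi setU11 /= andbT; congr (_ && _).
  apply/eqP/idP => [<-|/setU1K //]; by rewrite !inE eqxx.
by move=> Q /andP[_ /negPn iQ]; rewrite setD1K.
Qed.

(** In terms of [n i] and [n j], the sum is a + b (n i + n j) + c (n i)(n j) with natural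
    coefficients. The transfer keeps n i + n j and does not lower the product. *)
Lemma elem_sym_transfer (I : finType) (r : nat) (n n' : I -> nat) (i j : I) :
    i != j -> n j < n i -> n i = (n' i).+1 -> n' j = (n j).+1 ->
    (forall l, l != i -> l != j -> n' l = n l) ->
  elem_sym r n <= elem_sym r n'.
Proof.
move=> ij lt_ji ni nj nl; rewrite /elem_sym !(big_mkcond (fun Q => _ == r)) /=.
have jU Q : (i \notin j |: Q) = (i \notin Q) by rewrite !inE (negPf ij).
have split F : \sum_(Q : {set I}) F Q =
    \sum_(Q : {set I} | (i \notin Q) && (j \notin Q))
      (F Q + F (i |: Q) + (F (j |: Q) + F (i |: (j |: Q)))).
  by rewrite (big_set_split (i := i)) // (big_set_split (i := j)).
rewrite [X in X <= _]split [X in _ <= X]split.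
apply: leq_sum => Q /andP[iQ jQ].
rewrite !big_setU1 ?jU // !cardsU1 jU iQ jQ !add1n.
have -> : \prod_(l in Q) n' l = \prod_(l in Q) n l.
  apply: eq_bigr => l lQ; apply: nl; apply: contraTneq lQ => -> //.
move: (\prod_(l in Q) n l) => p; rewrite ni nj in lt_ji *.
have le_p : n j * p <= n' i * p by rewrite leq_mul.
rewrite /= !mulSn mulnDr.
by case: ifP => _; case: ifP => _; case: ifP => _; lia.
Qed.

(* If n differs from the balanced t, some n i exceeds t i and some n j is below
   t j; then n j < n i, so moving a unit from i to j does not decrease elem_sym. *)
Lemma elem_sym_balanced (I : finType) (r : nat) (n t : I -> nat) :
    \sum_i n i = \sum_i t i -> (forall i j, t i <= (t j).+1) ->
  elem_sym r n <= elem_sym r t.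
Proof.
move=> eq_sum bal; have [d] := ubnP (\sum_i (n i - t i)).
elim: d => // d IH in n eq_sum * => /ltnSE le_d.
have [/forallP le_nt | /forallPn /= [i]] := boolP [forall i, n i <= t i].
  have eq_nt : n =1 t.
    move=> i; apply/eqP; move: eq_sum; rewrite (bigD1 i) // [RHS](bigD1 i) //=.
    have : \sum_(j | j != i) n j <= \sum_(j | j != i) t j by apply: leq_sum.
    have := le_nt i; lia.
  by apply: eq_leq; apply: eq_bigr => Q _; apply: eq_bigr.
rewrite -ltnNge => lt_i.
have [/forallP ge_nt | /forallPn /= [j]] := boolP [forall j, t j <= n j].
  move: eq_sum; rewrite (bigD1 i) // [RHS](bigD1 i) //=.
  have : \sum_(j | j != i) t j <= \sum_(j | j != i) n j by apply: leq_sum.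
  lia.
rewrite -ltnNge => lt_j; have lt_ji : n j < n i by have := bal j i; lia.
have ij : i != j by apply: contraTneq lt_ji => ->; rewrite ltnn.
pose n' l := if l == i then (n i).-1 else if l == j then (n j).+1 else n l.
have n'i : n' i = (n i).-1 by rewrite /n' eqxx.
have n'j : n' j = (n j).+1 by rewrite /n' eq_sym (negPf ij) eqxx.
have n'l l : l != i -> l != j -> n' l = n l.
  by rewrite /n' => /negPf -> /negPf ->.
apply: (@leq_trans (elem_sym r n')).
  by apply: (@elem_sym_transfer _ r n n' i j) => //; rewrite n'i prednK //; lia.
apply: IH.
  rewrite -eq_sum (bigD1 i) // (bigD1 j) 1?eq_sym //=.
  rewrite [RHS](bigD1 i) // [X in _ = _ + X](bigD1 j) 1?eq_sym //= n'i n'j.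
  rewrite (eq_bigr n) => [|l /andP[]]; [lia | exact: n'l].
rewrite (leq_trans _ le_d) // (bigD1 i) // [X in _ < X](bigD1 i) //= n'i.
suff : \sum_(l | l != i) (n' l - t l) <= \sum_(l | l != i) (n l - t l) by lia.
apply: leq_sum => l li; have [->|lj] := eqVneq l j; last by rewrite n'l.
by rewrite n'j; lia.
Qed.

Lemma rainbow_comp (V I J : finType) (q : V -> I) (g : I -> J)
    (S : {set V}) :
  {in q @: S &, injective g} -> rainbow (g \o q) S = rainbow q S.
Proof. by move=> gI; rewrite /rainbow imset_comp card_in_imset. Qed.

(** Renaming the colours of [q] injectively into [I] keeps the rainbow sets and leaves the remaining
    fibres empty. Both counts become [elem_sym] over [I] with equal totals. *)
Lemma card_rainbows_le (V W I J : finType) (c : V -> I) (q : W -> J)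
    (r : nat) (i0 : I) :
    #|V| = #|W| -> (forall i j, #|c @^-1: [set i]| <= #|c @^-1: [set j]|.+1) ->
    #|q @: setT| <= #|I| ->
  #|[set S : {set W} | (#|S| == r) && rainbow q S]| <=
  #|[set S : {set V} | (#|S| == r) && rainbow c S]|.
Proof.
move=> eqVW bal leI.
have [g gI] : exists g : J -> I, {in q @: setT &, injective g}.
  exists (fun x => nth i0 (enum I) (index x (enum (q @: setT)))).
  have lt x : x \in q @: setT -> index x (enum (q @: setT)) < size (enum I).
    move=> xq; rewrite -cardE (leq_trans _ leI) // [X in _ < X]cardE index_mem.
    by rewrite mem_enum.
  move=> x y xq yq /eqP; rewrite nth_uniq ?lt ?enum_uniq // => /eqP.
  by move/index_inj => ->//; rewrite mem_enum.
have <- : [set S : {set W} | (#|S| == r) && rainbow (g \o q) S] =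
          [set S : {set W} | (#|S| == r) && rainbow q S].
  apply/setP => S; rewrite !inE rainbow_comp //.
  by move=> x y /imsetP[x' _ ->] /imsetP[y' _ ->]; apply: gI; apply: imset_f.
rewrite !card_rainbows; apply: elem_sym_balanced => //.
have fib (U : finType) (f : U -> I) : \sum_i #|f @^-1: [set i]| = #|U|.
  rewrite -sum1_card (partition_big f predT) //=; apply: eq_bigr => i _.
  by rewrite -sum1_card; apply: eq_bigl => x; rewrite !inE.
by rewrite !fib.
Qed.

(** * Upper bound for Berge-free hypergraphs *)

Lemma exists_superset_card (V : finType) (K : {set V}) (m : nat) :
  #|K| <= m <= #|V| -> exists2 L : {set V}, K \subset L & #|L| = m.
Proof.
case/andP=> Km mV.
have : 0 < #|[set A : {set V} | A \subset ~: K & #|A| == m - #|K|]|.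
  by rewrite cards_draws bin_gt0 [X in _ <= X]cardsCs setCK leq_sub2r.
case/card_gt0P => A; rewrite inE -disjoints_subset => /andP[dA /eqP cA].
exists (K :|: A); first exact: subsetUl.
by rewrite cardsU disjoint_setI0 1?disjoint_sym // cards0 subn0 cA subnKC.
Qed.

Lemma set2_eq (V : finType) (e : {set V}) (x y : V) :
  #|e| = 2 -> x \in e -> y \in e -> x != y -> e = [set x; y].
Proof.
move=> e2 xe ye xy; apply/esym/eqP; rewrite eqEcard cards2 xy e2 leqnn andbT.
by rewrite subUset !sub1set xe ye.
Qed.

Lemma Berge_free_le_rainbows (W : finType) (r k : nat)
    (H : {set {set W}}) :
    1 < r -> r + 2 < k -> uniform r H -> Berge_free (complete_graph k) H ->
  exists2 q : W -> W, #|q @: setT| <= k.-1 &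
    #|H| <= #|[set S : {set W} | (#|S| == r) && rainbow q S]|.
Proof.
move=> r1 rk uH fH.
(* On at most k - 1 vertices singleton classes suffice; otherwise there are enough vertices for k -
   1 nonempty classes. *)
case: (leqP #|W| k.-1) => [leW|ltW].
  exists id; first by rewrite imset_id cardsT.
  apply/subset_leq_card/subsetP => S SH.
  by rewrite inE uH // eqxx /rainbow imset_id eqxx.
have [Red [Blue [dRB RB2 noK leH]]] := red_blue_graph uH fH.
pose adj x y := [set x; y] \in Red :|: Blue.
have irr : irreflexive adj.
  by move=> x; apply/negP => /RB2; rewrite setUid cards1.
have sym : symmetric adj by move=> x y; rewrite /adj setUC.
(* A single weight for both counts makes the same map [p] serve red pairs and blue cliques. *)
pose w (S : {set W}) : nat := (S \in Red) + (S \in cliques r Blue).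
have wadj S : 0 < w S -> {in S &, forall x y, x != y -> adj x y}.
  rewrite addn_gt0 !lt0b => hS x y xS yS xy; case/orP: hS => hS.
    have SRB : S \in Red :|: Blue by rewrite inE hS.
    by rewrite /adj -(set2_eq (RB2 _ SRB) xS yS xy).
  move: hS; rewrite inE => /andP[_ /forall_inP/(_ [set x; y])].
  by rewrite cards2 xy subUset !sub1set xS yS /adj inE => -> //; rewrite orbT.
have [p [_ pp padj le_p]] := symmetrization setT irr sym wadj.
(* Distinct representatives are adjacent, so k of them would give a complete graph excluded by
   [noK]. *)
have cardK : #|p @: setT| <= k.-1.
  rewrite leqNgt; apply/negP => ltK; have leK : k <= #|p @: setT| by lia.
  pose phi (i : 'I_k) := enum_val (widen_ord leK i).
  have phiI : injective phi by move=> i j /enum_val_inj /(congr1 val) /= /val_inj.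
  apply: (noK phi phiI) => e.
  rewrite inE => /cards2P[i [j [ij ->]]].
  rewrite imsetU1 imset_set1.
  have [x _ ex] := imsetP (enum_valP (widen_ord leK i)).
  have [y _ ey] := imsetP (enum_valP (widen_ord leK j)).
  have xy : p x != p y by rewrite -ex -ey; apply: contra ij => /eqP /phiI ->.
  by rewrite /phi ex ey; apply: padj; rewrite ?inE.
have [|L KL cardL] := @exists_superset_card _ (p @: setT) k.-1.
  by rewrite cardK ltnW.
(* p factors through q, so that q splits the parts of p into k - 1 parts. *)
pose q x := if x \in L then x else p x.
have qL x : q x \in L.
  by rewrite /q; case: ifP => // _; rewrite (subsetP KL) // imset_f.
have qid : {in L, forall x, q x = x} by rewrite /q => x ->.
have pq x : p (q x) = p x by rewrite /q; case: ifP => // _; rewrite pp ?inE.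
have tr_pq (S : {set W}) : rainbow p S -> rainbow q S.
  move=> /rainbowP trS; apply/rainbowP => x y xS yS eq_q.
  by apply: trS => //; rewrite -pq eq_q pq.
exists q.
  by rewrite -cardL; apply/subset_leq_card/subsetP => _ /imsetP[x _ ->].
pose R := [set S : {set W} | rainbow p S && (p @: S \in Red)].
pose C := [set S : {set W} | rainbow p S && (p @: S \in cliques r Blue)].
have RP : {in R, forall e : {set W}, #|e| = 2 /\ rainbow q e}.
  move=> e; rewrite inE => /andP[tr eR]; split; last exact: tr_pq.
  by rewrite -(eqP tr) RB2 // inE eR.
have leHRC : #|H| <= #|R| + #|C|.
  have count (P Q : pred {set W}) :
      \sum_(S | P S) (Q S : nat) = #|[set S | P S && Q S]|.
    rewrite -sum1dep_card [RHS]big_mkcondr /=; apply: eq_bigr => S _.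
    by case: (Q S).
  have count_w (B : {set {set W}}) :
      \sum_(S : {set W} | S \subset setT) (S \in B) = #|B|.
    by rewrite (count _ (mem B)); apply: eq_card => S; rewrite inE subsetT.
  have count_p (B : {set {set W}}) :
      \sum_(S : {set W} | (S \subset setT) && rainbow p S) (p @: S \in B) =
      #|[set S : {set W} | rainbow p S && (p @: S \in B)]|.
    rewrite (count _ (fun S : {set W} => p @: S \in B)); apply: eq_card => S.
    by rewrite !inE subsetT.
  by apply: leq_trans leH _; move: le_p; rewrite !big_split /= !count_p !count_w.
have rL : r + 2 <= #|L| by rewrite cardL; lia.
have := red_pairs_le_rainbows r1 rL qL qid RP; set X := finset _ => leRX.
apply: leq_trans leHRC (leq_trans (leq_add leRX (leqnn _)) _).
(* A set in [X] contains a pair whose image under [p] is red, while all pairs in a set of [C] have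
   blue images. *)
have dXC : X :&: C = set0.
  apply/setP => S; rewrite !inE; apply/negP.
  case/andP=> /and3P[_ _ /exists_inP[e eR eS]] /andP[_ /andP[_ /forall_inP h]].
  have [e2 _] := RP e eR; move: eR; rewrite inE => /andP[tr eRed].
  have := h (p @: e); rewrite (eqP tr) e2 imsetS // => /(_ isT) eBlue.
  by have := disjointFr dRB eRed; rewrite eBlue.
have := cardsUI X C; rewrite dXC cards0 addn0 => <-.
apply/subset_leq_card/subsetP => S; rewrite !inE => /orP[/and3P[-> -> //]|].
by case/andP=> tr /andP[cS _]; rewrite -(eqP tr) cS tr_pq.
Qed.

(** * Extremality of the Turán hypergraph *)

Lemma complete_multipartiteE (V : finType) (r m : nat) (c : V -> 'I_m) :
  complete_multipartite r c =
  [set S : {set V} | (#|S| == r) && rainbow c S].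
Proof.
apply/setP => S; rewrite !inE; congr (_ && _).
apply/forallP/rainbowP => [h x y xS yS eqc | cI j].
  by apply: (card_le1_eqP (h (c x))); rewrite !inE ?xS ?yS ?eqc eqxx.
apply/card_le1_eqP => x y; rewrite !inE => /andP[xS /eqP xj] /andP[yS /eqP yj].
by apply: cI => //; rewrite xj yj.
Qed.

Lemma balanced_fibers (V : finType) (m : nat) (c : V -> 'I_m) (i j : 'I_m) :
  balanced c -> #|c @^-1: [set i]| <= #|c @^-1: [set j]|.+1.
Proof.
have fib l : part c l = c @^-1: [set l] by apply/setP => x; rewrite !inE.
have m0 : 0 < m by apply: leq_ltn_trans (ltn_ord i).
have gap : (#|V| + m.-1) %/ m <= (#|V| %/ m).+1.
  have -> : (#|V| %/ m).+1 = (#|V| + m) %/ m.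
    by rewrite divnDr ?dvdnn // divnn m0 addn1.
  by rewrite leq_div2r // leq_add2l leq_pred.
have up : #|V| %/ m <= (#|V| + m.-1) %/ m by rewrite leq_div2r ?leq_addr.
by move=> bal; have := bal i; have := bal j; rewrite !fib; lia.
Qed.

Theorem corollary22 (r k n : nat) (hr : 2 <= r) (hk : r + 2 < k) (hn : 0 < n)
    (V : finType) (hV : #|V| = n) (T : {set {set V}})
    (hT : is_Turan r k.-1 T) :
  [/\ uniform r T,
      Berge_free (complete_graph k) T &
      forall (W : finType) (H : {set {set W}}),
        #|W| = n -> uniform r H -> Berge_free (complete_graph k) H ->
        #|H| <= #|T|].
Proof.
have k1 : 0 < k.-1 by lia.
have [c bal ->] := hT; rewrite complete_multipartiteE; split.
- by move=> e; rewrite inE => /andP[/eqP].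
- case=> phi [f [phiI fT _ sub_f]].
  (* Two of the k vertices of a Berge copy share one of the k - 1 parts, but the hyperedge of that
     pair meets the part at most once. *)
  have /injectivePn[i [j ij eq_c]] : ~~ injectiveb (c \o phi).
    by apply/injectiveP => /leq_card; rewrite !card_ord; lia.
  have eK : [set i; j] \in complete_graph k by rewrite inE cards2 ij.
  have := fT _ eK; rewrite inE => /andP[_ /rainbowP cI].
  have in_f l : l \in [set i; j] -> phi l \in f [set i; j].
    by move=> lij; rewrite (subsetP (sub_f _ eK)) // imset_f.
  move: ij; rewrite (phiI i j) ?eqxx //.
  by apply: cI eq_c; apply: in_f; rewrite !inE eqxx ?orbT.
- move=> W H hW uH fH.
  have [q leq leH] := Berge_free_le_rainbows hr hk uH fH.
  apply: leq_trans leH (card_rainbows_le _ (Ordinal k1) _ _ _).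
  + by rewrite hV hW.
  + by move=> i j; apply: balanced_fibers.
  + by rewrite card_ord.
Qed.
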